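(* If $D$ is a strong digraph of order at least three, then $\mathsf{d}_s^-(L(D))=\Lambda(D)$.
   Context: Digraphs are finite, loopless, without parallel arcs. A digraph is strong if for every ordered pair $u,v$ there is a directed $uv$-walk. The line digraph $L(D)$ has vertex set $A(D)$ and an arc from $(u,v)$ to $(w,z)$ iff $v=w$. For $E\subseteq A(D)$, $D[E]$ is the subdigraph with arc set $E$ and vertex set the end-vertices of arcs in $E$; a nonempty $E$ is a strong cover of $D$ if $D[E]$ is a spanning strong subdigraph of $D$. $\Lambda(D)$ is the maximum number of classes in a partition of $A(D)$ into strong covers. $S$ is in-dominating in $H$ if every vertex not in $S$ has an out-neighbor in $S$; strong in-dominating if moreover $H\langle S\rangle$ is strong; $\mathsf{d}_s^-(H)$ is the maximum number of classes of a partition of $V(H)$ into strong in-dominating sets. *)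

(* Defs.v *)
From mathcomp Require Import all_boot.

Set Implicit Arguments.
Unset Strict Implicit.
Unset Printing Implicit Defensive.

(* Parallel arcs are excluded because [is_arc] is a relation. *)
Record digraph := Digraph {
  vertex : finType;
  is_arc : rel vertex;
  is_arc_irr : irreflexive is_arc
}.

Definition dorder (D : digraph) : nat := #|vertex D|.

(* [connect] is reflexive: the walk of length 0 joins a vertex to itself, so a
   one-vertex digraph is strong. *)
Definition strong (D : digraph) : bool :=
  [forall u : vertex D, forall v : vertex D, connect (@is_arc D) u v].

(* The arc set A(D), as a finite type of ordered pairs (tail, head). *)
Definition arcs (D : digraph) : finType :=
  {p : vertex D * vertex D | @is_arc D p.1 p.2}.

Definition arc_tail (D : digraph) (a : arcs D) : vertex D := (val a).1.
Definition arc_head (D : digraph) (a : arcs D) : vertex D := (val a).2.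

Definition line_rel (D : digraph) : rel (arcs D) :=
  fun a b => arc_head a == arc_tail b.

Lemma line_rel_irr (D : digraph) : irreflexive (@line_rel D).
Proof.
move=> a; apply/negP => /eqP eq_ht; have := valP a.
by rewrite -/(arc_tail a) -/(arc_head a) eq_ht is_arc_irr.
Qed.

Definition line_digraph (D : digraph) : digraph :=
  Digraph (@line_rel_irr D).

Definition induced_rel (H : digraph) (S : {set vertex H}) :
    rel {x : vertex H | x \in S} :=
  fun x y => @is_arc H (val x) (val y).

Lemma induced_rel_irr (H : digraph) (S : {set vertex H}) :
  irreflexive (@induced_rel H S).
Proof. by move=> x; apply: is_arc_irr. Qed.

Definition induced (H : digraph) (S : {set vertex H}) : digraph :=
  Digraph (@induced_rel_irr H S).

(* D[E] has only the end-vertices of arcs of E as vertices, so that it spans D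
   exactly when [end_vertices E] is full. *)
Definition end_vertices (D : digraph) (E : {set arcs D}) : {set vertex D} :=
  [set v | [exists a in E, (v == arc_tail a) || (v == arc_head a)]].

Definition arc_induced_rel (D : digraph) (E : {set arcs D}) :
    rel {v : vertex D | v \in end_vertices E} :=
  fun u v => [exists a in E, (arc_tail a == val u) && (arc_head a == val v)].

Lemma arc_induced_rel_irr (D : digraph) (E : {set arcs D}) :
  irreflexive (@arc_induced_rel D E).
Proof.
move=> u; apply/exists_inP => -[a _ /andP[/eqP tu /eqP hu]].
by have := line_rel_irr a; rewrite /line_rel tu hu eqxx.
Qed.

Definition arc_induced (D : digraph) (E : {set arcs D}) : digraph :=
  Digraph (@arc_induced_rel_irr D E).

Definition strong_cover (D : digraph) (E : {set arcs D}) : bool :=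
  [&& E != set0, end_vertices E == [set: vertex D] & strong (arc_induced E)].

Definition in_dominating (H : digraph) (S : {set vertex H}) : bool :=
  [forall x : vertex H, (x \notin S) ==> [exists y in S, @is_arc H x y]].

Definition strong_in_dominating (H : digraph) (S : {set vertex H}) : bool :=
  in_dominating S && strong (induced S).

(* The maximum number of classes of a partition of T into sets satisfying Q;
   classes are nonempty, and the value is 0 when there is no such partition. *)
Definition max_partition (T : finType) (Q : pred {set T}) : nat :=
  \max_(P : {set {set T}} | partition P [set: T] && [forall S in P, Q S]) #|P|.

Definition Lambda (D : digraph) : nat := max_partition (@strong_cover D).

Definition ds_minus (H : digraph) : nat :=
  max_partition (@strong_in_dominating H).

(* Main.v *)
(** A set of arcs of [D] is a strong cover exactly when it is a strong
    in-dominating set of [L(D)], so both parameters are maxima over the same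
    partitions.  Walks of [D[E]] and of [L(D)<E>] correspond to each other.  A
    strong in-dominating set [S] spans [D], because every vertex is the head of
    some arc; as [D] has at least three vertices, [S] is then not a single arc,
    and strength of [L(D)<S>] gives every vertex both an incoming and an outgoing
    arc in [S]. *)
Require Import Defs.
From mathcomp Require Import all_boot.

Set Implicit Arguments.
Unset Strict Implicit.
Unset Printing Implicit Defensive.

Lemma connect_out (T : finType) (e : rel T) (x y : T) :
  connect e x y -> x != y -> exists z, e x z.
Proof.
by case/connectP => [[|z p] /= + ->]; rewrite ?eqxx // => /andP[exz _]; exists z.
Qed.

Lemma connect_in (T : finType) (e : rel T) (x y : T) :
  connect e x y -> x != y -> exists z, e z y.
Proof.
case/connectP; case/lastP => [|p z] /=; first by move=> _ ->; rewrite eqxx.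
by rewrite rcons_path last_rcons => /andP[_ ez] -> _; exists (last x p).
Qed.

Lemma exists_neq (T : finType) (x : T) : 1 < #|T| -> exists y, y != x.
Proof.
rewrite (cardD1 x) inE ltnS => /card_gt0P[y].
by rewrite !inE andbT => yx; exists y.
Qed.

Section LineDigraph.

Variable D : digraph.

Local Notation LD := (line_digraph D).

Lemma mem_tail (E : {set arcs D}) (a : arcs D) :
  a \in E -> arc_tail a \in end_vertices E.
Proof. by move=> aE; rewrite inE; apply/exists_inP; exists a; rewrite ?eqxx. Qed.

Lemma mem_head (E : {set arcs D}) (a : arcs D) :
  a \in E -> arc_head a \in end_vertices E.
Proof.
by move=> aE; rewrite inE; apply/exists_inP; exists a; rewrite ?eqxx ?orbT.
Qed.

(** The arcs of a walk from [u] to [v] are themselves successive vertices of the line digraph, and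
    they fit between [a], which enters [u], and [b], which leaves [v]. The empty walk yields the
    single arc from [a] to [b]. *)
Lemma connect_line (E : {set arcs D}) (u v : vertex (arc_induced E))
    (a b : vertex (@induced LD E)) :
  connect (@is_arc (arc_induced E)) u v ->
  arc_head (val a) = val u -> arc_tail (val b) = val v ->
  connect (@is_arc (@induced LD E)) a b.
Proof.
case/connectP => p; elim: p u a => [|w p IHp] u a /=.
  by move=> _ -> hu tv; apply: connect1; apply/eqP; rewrite hu tv.
case/andP => /exists_inP[c cE /andP[/eqP tc /eqP hc]] pth lst hu tv.
pose c' : vertex (@induced LD E) := Sub c cE.
have ac : @is_arc (@induced LD E) a c' by apply/eqP; rewrite hu -tc.
by apply: connect_trans (connect1 ac) _; apply: IHp pth lst _ tv.
Qed.

(** Here [a] leaves [u] and [b] enters [v], so both are traversed: even the empty walk, where [a]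
    equals [b], contributes one arc from [u] to [v]. *)
Lemma connect_unline (E : {set arcs D}) (a b : vertex (@induced LD E))
    (u v : vertex (arc_induced E)) :
  connect (@is_arc (@induced LD E)) a b ->
  arc_tail (val a) = val u -> arc_head (val b) = val v ->
  connect (@is_arc (arc_induced E)) u v.
Proof.
case/connectP => p; elim: p a u => [|c p IHp] a u /=.
  move=> _ -> tu hv; apply: connect1; apply/exists_inP.
  by exists (val a); rewrite ?tu ?hv ?eqxx //; apply: valP.
case/andP => /eqP ac pth lst tu hv.
pose w : vertex (arc_induced E) := Sub (arc_head (val a)) (mem_head (valP a)).
have uw : @is_arc (arc_induced E) u w.
  by apply/exists_inP; exists (val a); rewrite ?tu ?eqxx //; apply: valP.
by apply: connect_trans (connect1 uw) _; apply: IHp pth lst _ hv.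
Qed.

Lemma strong_has_in_arc (v : vertex D) :
  strong D -> 1 < dorder D -> exists a : arcs D, arc_head a = v.
Proof.
move=> /forallP strD /(exists_neq v)[u uv].
have [w wv] := connect_in (forallP (strD u) v) uv.
by exists (Sub (w, v) wv).
Qed.

Lemma strong_cover_out_arc (E : {set arcs D}) (v : vertex D) :
  1 < dorder D -> strong_cover E -> exists2 a, a \in E & arc_tail a = v.
Proof.
move=> /(exists_neq v)[w wv] /and3P[_ /eqP spanE /forallP strE].
have memV x : x \in end_vertices E by rewrite spanE inE.
pose inV x : vertex (arc_induced E) := Sub x (memV x).
(* The first arc of a walk from [v] to another vertex [w] lies in [E]. *)
have [|z] := connect_out (forallP (strE (inV v)) (inV w)).
  by rewrite -val_eqE /= eq_sym.
by case/exists_inP => a aE /andP[/eqP ta _]; exists a.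
Qed.

Lemma strong_cover_in_dominating (E : {set arcs D}) :
  1 < dorder D -> strong_cover E -> @strong_in_dominating LD E.
Proof.
move=> ord covE; apply/andP; split.
  apply/forallP => x; apply/implyP => _.
  have [a aE ta] := strong_cover_out_arc (arc_head x) ord covE.
  by apply/exists_inP; exists a => //; apply/eqP.
have /and3P[_ _ /forallP strE] := covE.
apply/forallP => a; apply/forallP => b.
pose u : vertex (arc_induced E) := Sub (arc_head (val a)) (mem_head (valP a)).
pose v : vertex (arc_induced E) := Sub (arc_tail (val b)) (mem_tail (valP b)).
exact: connect_line (forallP (strE u) v) _ _.
Qed.

(** Some arc [a] of [D] enters [v]; either [a] is in [S], or it is dominated by an arc of [S]
    leaving [v]. *)
Lemma in_dominating_spanning (S : {set arcs D}) (v : vertex D) :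
  strong D -> 1 < dorder D -> @in_dominating LD S -> v \in end_vertices S.
Proof.
move=> strD ord /forallP domS.
have [a <-] := strong_has_in_arc v strD ord.
have [aS|aS] := boolP (a \in S); first exact: mem_head.
have /exists_inP[b bS /eqP ->] := implyP (domS a) aS.
exact: mem_tail.
Qed.

(** If [S] had no arc besides [a], its end-vertices would be the at most two ends of [a]. *)
Lemma spanning_other_arc (S : {set arcs D}) (a : arcs D) :
  2 < dorder D -> (forall v, v \in end_vertices S) ->
  exists2 b, b \in S & b != a.
Proof.
move=> ord spanS; apply/exists_inP; apply: contraLR ord => /exists_inPn Sa.
rewrite -leqNgt -[dorder D]cardsT.
apply: (@leq_trans #|[set arc_tail a; arc_head a]|); last first.
  by rewrite cards2; case: (_ != _).
apply/subset_leq_card/subsetP => v _.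
have := spanS v; rewrite !inE => /exists_inP[b bS].
by have /negPn/eqP-> := Sa b bS.
Qed.

Lemma in_dominating_strong_cover (S : {set arcs D}) :
  strong D -> 2 < dorder D -> @strong_in_dominating LD S -> strong_cover S.
Proof.
move=> strD ord /andP[domS /forallP strS].
have spanS v : v \in end_vertices S.
  exact: in_dominating_spanning strD (ltnW ord) domS.
have tailS v : exists2 a, a \in S & arc_tail a = v.
  have := spanS v; rewrite inE => /exists_inP[a aS /orP[]/eqP->].
    by exists a.
  (* Now [v] is the head of [a]: a walk in the line digraph from [a] to another arc [b] first steps
     to an arc leaving [v]. *)
  have [b bS ba] := spanning_other_arc a ord spanS.
  pose a' : vertex (@induced LD S) := Sub a aS.
  have [|c /eqP ac] := connect_out (forallP (strS a') (Sub b bS)).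
    by rewrite -val_eqE /= eq_sym.
  by exists (val c); first exact: valP.
have headS v : exists2 a, a \in S & arc_head a = v.
  have := spanS v; rewrite inE => /exists_inP[a aS /orP[]/eqP->]; last by exists a.
  (* Dually, [v] is the tail of [a], and the last step of a walk from [b] to [a] comes from an arc
     entering [v]. *)
  have [b bS ba] := spanning_other_arc a ord spanS.
  pose a' : vertex (@induced LD S) := Sub a aS.
  have [|c /eqP ca] := connect_in (forallP (strS (Sub b bS)) a').
    by rewrite -val_eqE.
  by exists (val c); first exact: valP.
apply/and3P; split.
- have /card_gt0P[v _] : 0 < #|vertex D| by apply: leq_trans ord.
  by have [a aS _] := tailS v; apply/set0Pn; exists a.
- by apply/eqP/setP => v; rewrite spanS inE.
apply/forallP => u; apply/forallP => v.
(* A walk from an arc out of [u] to an arc into [v] gives a walk from [u] to [v]. *)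
have [a aS ta] := tailS (val u); have [b bS hb] := headS (val v).
exact: connect_unline (forallP (strS (Sub a aS)) (Sub b bS)) ta hb.
Qed.

End LineDigraph.

Theorem theorem9 (D : digraph) (hstrong : strong D) (hord : 3 <= dorder D) :
  ds_minus (line_digraph D) = Lambda D.
Proof.
apply: eq_bigl => P; congr (_ && _); apply: eq_forallb => S; congr (_ ==> _).
apply/idP/idP; first exact: in_dominating_strong_cover.
exact/strong_cover_in_dominating/ltnW.
Qed.
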